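(* Let $q=2^m$ with $m$ even, let $c_1,c_2,c_3,\gamma\in\mathbb{F}_{q^2}$, put $h_1(x)=\mathrm{Tr}_q^{q^2}\bigl(c_1x+c_2x^2+c_3x^3+x^{q+2}\bigr)$, and suppose that $f_1(x)=x+\gamma h_1(x)$ is a permutation polynomial of $\mathbb{F}_{q^2}$. Then one of the following three cases holds, and in each case the compositional inverse of $f_1$ on $\mathbb{F}_{q^2}$ is as indicated: $$f_1^{-1}(x)=\begin{cases} x & \text{if } \gamma=0,\\[4pt] x+\dfrac{\gamma\,h_1(x)}{1+\gamma\,\mathrm{Tr}_q^{q^2}(c_1)} & \text{if } \gamma\in\mathbb{F}_q^*,\ c_3=1,\ \mathrm{Tr}_q^{q^2}(c_2)=0,\\[8pt] x+\left(\dfrac{h_1(x)}{\mathrm{Tr}_q^{q^2}(c_2)}\right)^{q/2} & \text{if } \gamma\in\mathbb{F}_q^*,\ c_3=1,\ \mathrm{Tr}_q^{q^2}(c_2)\neq0.\end{cases}$$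
   Context: $m\geq 1$ is an integer, $\mathbb{F}_q$ denotes the finite field with $q$ elements and $\mathbb{F}_q^*=\mathbb{F}_q\setminus\{0\}$. $\mathrm{Tr}_q^{q^2}:\mathbb{F}_{q^2}\to\mathbb{F}_q$ is the relative trace $\mathrm{Tr}_q^{q^2}(x)=x+x^q$. A polynomial $f$ over $\mathbb{F}_{q^2}$ is a permutation polynomial of $\mathbb{F}_{q^2}$ if the map $a\mapsto f(a)$ is a bijection of $\mathbb{F}_{q^2}$; its compositional inverse $f^{-1}$ is the inverse map $\mathbb{F}_{q^2}\to\mathbb{F}_{q^2}$. *)

(* Defs.v *)
From HB Require Import structures.
From mathcomp Require Import all_boot all_order all_algebra all_field.

Set Implicit Arguments.
Unset Strict Implicit.
Unset Printing Implicit Defensive.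

Import GRing.Theory.
Local Open Scope ring_scope.

(* The extension F_{q^2} / F_q is a field extension L of degree 2 of a finite *)
(* field K with #|K| = q; as a subset of L, F_q is the line 1%VS spanned by 1 *)
(* over K.                                                                    *)

(* Over an arbitrary ring, so that it applies both to elements of F_{q^2} and *)
(* to polynomials: (reltrace q p).[a] = reltrace q p.[a] in a commutative     *)
(* ring.                                                                      *)
Definition reltrace (R : nzRingType) (q : nat) (x : R) : R := x + x ^+ q.

Definition permutation_poly (L : fieldType) (f : {poly L}) : Prop :=
  bijective (fun a : L => f.[a]).

Definition compositional_inverse (L : fieldType) (f : {poly L}) (g : L -> L)
  : Prop :=
  cancel (fun a : L => f.[a]) g /\ cancel g (fun a : L => f.[a]).

Definition h1 (L : fieldType) (q : nat) (c1 c2 c3 : L) : {poly L} :=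
  reltrace q (c1 *: 'X + c2 *: 'X^2 + c3 *: 'X^3 + 'X^(q + 2)).

Definition f1 (L : fieldType) (q : nat) (c1 c2 c3 gamma : L) : {poly L} :=
  'X + gamma *: h1 q c1 c2 c3.

(* Main.v *)
Require Import Defs.
From HB Require Import structures.
From mathcomp Require Import all_boot all_order all_algebra all_field.
From mathcomp Require Import ring.

Set Implicit Arguments.
Unset Strict Implicit.
Unset Printing Implicit Defensive.

Import GRing.Theory.
Local Open Scope ring_scope.

(** Write Fq for the fixed points of x |-> x^q in L, and Tr for the relative
trace, a nondegenerate Fq-linear map L -> Fq.  Since h1 takes its values in Fq,
f1 moves each point x along the line x + gamma Fq, and on that line it acts as
a polynomial of degree at most 3 in the parameter t (lemma [f1_line]):
  f1 (x + gamma t) = f1 x + gamma (A t^3 + B_x t^2 + (1 + C_x) t).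
For gamma != 0, injectivity of f1 makes each of these polynomials injective on
Fq.

Such a polynomial cannot have A != 0 ([cubic_inj]).  In characteristic 2, a
translation of the variable brings it to the shape y^3 + k y, and Cardano's
formula then exhibits a collision: if u v = k, the points u + v and
w^2 u + w v, for w a primitive cube root of unity, have the same image
u^3 + v^3.  This is where m even matters: it puts w in Fq.  So A = 0, and
injectivity of the additive polynomial B_x t^2 + (1 + C_x) t says that exactly
one of its two coefficients is zero ([quadratic_inj]).

The coefficients depend on x through B_x = e + Tr (eps x) and
1 + C_x = c + Tr (delta x^2), with eps = c3 gamma^2 + gamma^(2 q) and
delta = c3 gamma + gamma^q.  Exactly one of them can be zero at every x only
when both are constant ([exclusive_zeros_const]), that is, eps = delta = 0.
Eliminating c3 gives gamma^q = gamma, hence gamma in Fq and c3 = 1, and exactly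
one of Tr c2 and 1 + gamma Tr c1 is zero.

Finally, taking t = h1 x in the expansion along a line yields
  h1 (f1 x) = gamma^2 Tr c2 (h1 x)^2 + (1 + gamma Tr c1) h1 x,
with only one of the two terms present.  In either case gamma (h1 x) can be
computed from h1 (f1 x), where a square root on Fq is the power q/2, and
x = f1 x + gamma (h1 x). *)

(** * Injective polynomials of degree at most 3 in characteristic 2 *)

(** With n = (#|K| - 1) / 3, not every nonzero element of K is a root of
X^n - 1; the value a^n at an exception a is the required w. *)
Lemma finField_cube_root_unity (K : finFieldType) :
  #|K| = 1 %[mod 3] -> exists w : K, w ^+ 2 + w + 1 = 0.
Proof.
move=> K1; have K_gt1 : (1 < #|K|)%N by exact: finNzRing_gt1.
have /dvdnP[n nE] : (3 %| #|K|.-1)%N.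
  by rewrite -subn1 -eqn_mod_dvd ?(ltnW K_gt1)//; apply/eqP.
have n_gt0 : (0 < n)%N.
  rewrite lt0n; apply/negP => /eqP n0; move: K_gt1 nE; rewrite n0.
  by case: #|K| => [|[]].
have [a /andP[a_neq0 an]] : exists a : K, (a != 0) && (a ^+ n != 1).
  apply/existsP; rewrite -[[exists _, _]]negbK negb_exists.
  apply/negP => /forallP noroot.
  have /max_unity_roots : all n.-unity_root (enum (predC1 (0 : K))).
    apply/allP => a; rewrite mem_enum inE => a0; rewrite unity_rootE.
    by have := noroot a; rewrite a0 negbK.
  move=> /(_ n_gt0 (enum_uniq _)).
  by rewrite -cardE cardC1 nE leqNgt ltn_Pmulr.
exists (a ^+ n); apply: (mulfI (_ : a ^+ n - 1 != 0)).
  by rewrite subr_eq0.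
rewrite mulr0 (_ : _ * _ = a ^+ n ^+ 3 - 1); last by ring.
apply/eqP; rewrite subr_eq0 -exprM -nE; apply/eqP/(mulfI a_neq0).
by rewrite -exprS mulr1 prednK ?expf_card // ltnW.
Qed.

(** In characteristic 2 the Cardano identity keeps only one mixed term,
because 3 = 1. *)
Lemma cubeD_pchar2 (R : comNzRingType) (a b : R) : 2 \in [pchar R] ->
  (a + b) ^+ 3 + a * b * (a + b) = a ^+ 3 + b ^+ 3.
Proof.
move=> R2; have two0 : 1 + 1 = 0 :> R by apply: addrr_pchar2.
transitivity (a ^+ 3 + b ^+ 3 + (1 + 1) * (2 * a * b * (a + b))); first by ring.
by rewrite two0 mul0r addr0.
Qed.

(** Any monic cubic without constant term has this form as soon as u v is
its linear coefficient minus b^2; translating by b removes both the square term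
and b^2, leaving y^3 + u v y.  The substitution (u, v) -> (w^2 u, w v) preserves
u v and u^3 + v^3. *)
Lemma cardano_collision (F : fieldType) (w b u v : F) :
    2 \in [pchar F] -> w ^+ 2 + w + 1 = 0 ->
    let p t := t ^+ 3 + b * t ^+ 2 + (b ^+ 2 + u * v) * t in
  p (u + v + b) = p (w ^+ 2 * u + w * v + b).
Proof.
move=> F2 wE p; have two0 : 1 + 1 = 0 :> F by apply: addrr_pchar2.
have w3 : w ^+ 3 = 1.
  apply/eqP; rewrite -subr_eq0; apply/eqP.
  by transitivity ((w - 1) * (w ^+ 2 + w + 1)); [ring | rewrite wE mulr0].
have pE y : p (y + b) = y ^+ 3 + u * v * y + p b.
  apply/eqP; rewrite -subr_eq0; apply/eqP.
  transitivity ((1 + 1) * (2 * b * y ^+ 2 + 3 * b ^+ 2 * y)).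
    by rewrite /p; ring.
  by rewrite two0 mul0r.
rewrite !pE cubeD_pchar2//; congr (_ + _).
have -> : u * v = (w ^+ 2 * u) * (w * v) by rewrite -[LHS]mul1r -w3; ring.
rewrite cubeD_pchar2//.
transitivity ((w ^+ 3) ^+ 2 * u ^+ 3 + w ^+ 3 * v ^+ 3); last by ring.
by rewrite w3 expr1n !mul1r.
Qed.

(** The collision must consist of two distinct points of E.  Cardano's points
u + v + b and w^2 u + w v + b coincide only when u^2 = w u v = w k, and at least
one of the nonzero elements u = 1 and u = w avoids this. *)
Lemma cubic_inj (F : fieldType) (L : fieldExtType F) (E : {subfield L})
    (w A B C : L) :
    2 \in [pchar L] -> w \in E -> w ^+ 2 + w + 1 = 0 ->
    A \in E -> B \in E -> C \in E ->
    {in E &, injective (fun t => A * t ^+ 3 + B * t ^+ 2 + C * t)} ->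
  A = 0.
Proof.
move=> L2 wE w_root AE BE CE p_inj; apply/eqP/negPn/negP => A_neq0.
pose b := B / A; pose k := b ^+ 2 + C / A.
have two0 : 1 + 1 = 0 :> L by apply: addrr_pchar2.
have w_neq0 : w != 0.
  apply/eqP => w0; move/eqP: w_root.
  by rewrite w0 expr0n !add0r oner_eq0.
have bE : b \in E by rewrite rpred_div.
have kE : k \in E by rewrite rpredD ?rpredX ?rpred_div.
have [u [uE u_neq0 u_ok]] : exists u, [/\ u \in E, u != 0 & u ^+ 2 != w * k].
  have [wk1|] := eqVneq (w * k) 1.
    exists w; split=> //; rewrite wk1; apply/eqP => w2.
    move/eqP: w_root; rewrite w2 addrAC two0 add0r; exact/negP.
  by move=> wk; exists 1; rewrite mem1v oner_eq0 expr1n eq_sym.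
pose v := k / u; have vE : v \in E by rewrite rpred_div.
have uv : u * v = k by rewrite /v mulrC divfK.
suff /negP[] : (u + v + b) != (w ^+ 2 * u + w * v + b).
  have sE : u + v + b \in E by rewrite !rpredD.
  have tE : w ^+ 2 * u + w * v + b \in E.
    apply: rpredD bE; apply: rpredD; apply: rpredM => //; exact: rpredX.
  apply/eqP/p_inj => //=.
  have pE t : A * t ^+ 3 + B * t ^+ 2 + C * t =
              A * (t ^+ 3 + b * t ^+ 2 + (b ^+ 2 + u * v) * t).
    rewrite uv; apply/eqP; rewrite -subr_eq0; apply/eqP.
    transitivity ((1 + 1) * (- A * b ^+ 2 * t)); first by rewrite /k /b; field.
    by rewrite two0 mul0r.
  by rewrite !pE (cardano_collision _ _ _ L2 w_root).
apply: contra_neq u_ok => /addIr/eqP; rewrite -subr_eq0 => /eqP eq_st.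
apply: (mulfI w_neq0); rewrite -uv; apply/eqP; rewrite -subr_eq0; apply/eqP.
transitivity (u * ((u + v - (w ^+ 2 * u + w * v)) +
                   (w ^+ 2 + w + 1) * (u - v) + (1 + 1) * (w * v - u))).
  by ring.
by rewrite eq_st w_root two0 !mul0r !addr0 mulr0.
Qed.

(** If both coefficients are nonzero, C / B is a second zero besides 0, because
2 = 0. *)
Lemma quadratic_inj (F : fieldType) (L : fieldExtType F) (E : {subfield L})
    (B C : L) :
    2 \in [pchar L] -> B \in E -> C \in E ->
    {in E &, injective (fun t => B * t ^+ 2 + C * t)} ->
  (B == 0) = (C != 0).
Proof.
move=> L2 BE CE p_inj.
have [B0|B_neq0] := eqVneq B 0; have [C0|C_neq0] := eqVneq C 0 => //.
  have /eqP : 1 = 0 :> L by apply: p_inj; rewrite ?mem1v ?mem0v ?B0 ?C0 ?mul0r.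
  by rewrite oner_eq0.
have /eqP : C / B = 0.
  apply: p_inj; rewrite ?mem0v ?rpred_div//.
  rewrite expr0n !mulr0 addr0 (_ : _ + _ = (1 + 1) * (C ^+ 2 / B)).
    by rewrite (addrr_pchar2 L2) mul0r.
  by field.
by rewrite mulf_eq0 invr_eq0 (negPf B_neq0) (negPf C_neq0).
Qed.

(** * Frobenius and the relative trace on a quadratic extension *)

Section QuadraticExtension.

Variables (m q : nat) (K : finFieldType) (L : fieldExtType K).
Hypotheses (m_gt0 : (0 < m)%N) (q_def : q = (2 ^ m)%N) (card_K : #|K| = q).
Hypothesis dim_L : \dim {:L} = 2%N.

Local Notation Fq := (1%AS : {subfield L}).
Local Notation Tr := (@reltrace L q).

Implicit Types (a c e t x y : L).

Lemma pchar_L : 2 \in [pchar L].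
Proof. by rewrite pchar_lalg (@card_finPcharP K 2 m) ?card_K. Qed.

Let two0 : 1 + 1 = 0 :> L := addrr_pchar2 pchar_L 1.

Lemma mem_FqE x : (x \in Fq) = (x ^+ q == x).
Proof. by rewrite Fermat's_little_theorem dimv1 expn1 card_K. Qed.

Lemma frob_Fq t : t \in Fq -> t ^+ q = t.
Proof. by rewrite mem_FqE => /eqP. Qed.

Lemma frobK x : (x ^+ q) ^+ q = x.
Proof.
have := memvf x; rewrite (Fermat's_little_theorem {:L}%AS) => /eqP.
by rewrite dim_L card_K expnS expn1 exprM.
Qed.

Lemma frobD x y : (x + y) ^+ q = x ^+ q + y ^+ q.
Proof.
by rewrite exprDn_pchar // (eq_pnat _ (pcharf_eq pchar_L)) q_def pnatX.
Qed.

Lemma halfqK : (q %/ 2 * 2)%N = q.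
Proof. by rewrite divnK // q_def -(prednK m_gt0) expnS dvdn_mulr. Qed.

Lemma Fq_sqrtK t : t \in Fq -> (t ^+ (q %/ 2)) ^+ 2 = t.
Proof. by move=> tE; rewrite -exprM halfqK frob_Fq. Qed.

Lemma sqr_surj y : exists x, x ^+ 2 = y.
Proof. by exists ((y ^+ q) ^+ (q %/ 2)); rewrite -exprM halfqK frobK. Qed.

Lemma reltrace_Fq x : Tr x \in Fq.
Proof. by rewrite mem_FqE frobD frobK addrC. Qed.

Lemma reltraceD x y : Tr (x + y) = Tr x + Tr y.
Proof. by rewrite /reltrace frobD addrACA. Qed.

Lemma reltraceZ t x : t \in Fq -> Tr (t * x) = t * Tr x.
Proof. by move=> tE; rewrite /reltrace exprMn frob_Fq// mulrDr. Qed.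

Lemma reltrace0 : Tr 0 = 0.
Proof. by rewrite -[X in Tr X](mulr0 0) reltraceZ ?mem0v// mul0r. Qed.

Lemma reltrace_frob x : Tr (x ^+ q) = Tr x.
Proof. by rewrite /reltrace frobK addrC. Qed.

(** If Tr vanished at some y outside Fq, then y^q = - y = y would put y
in Fq. *)
Lemma reltrace_nondegenerate a : a != 0 -> exists x, Tr (a * x) != 0.
Proof.
move=> a_neq0; have [y yNFq] : exists y, y \notin Fq.
  have : ~~ ({:L} <= Fq)%VS.
    by apply/negP => /dimvS; rewrite dim_L dimv1.
  by case/subvPn => y _ yN; exists y.
exists (y / a); rewrite mulrC divfK//; apply: contraNneq yNFq => Try0.
rewrite mem_FqE; apply/eqP/(addrI y).
by rewrite -[LHS]/(Tr y) Try0 (addrr_pchar2 pchar_L).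
Qed.

(** * The coefficients along the lines of direction gamma *)

(** Along a ray k |-> k x, with k in Fq, the first expression is affine in k
and the second is affine in k^2.  If Tr (eps y) is nonzero, the first one has a
single zero on the ray of y, so the second would have to vanish at all other
parameters, hence everywhere because Fq has more than two elements (0, 1 and w
suffice).  So the first expression is constant.  If Tr (delta x^2) is nonzero,
the second one takes both zero and nonzero values on the ray of x. *)
Lemma exclusive_zeros_const (w e c eps delta : L) :
    w \in Fq -> w ^+ 2 + w + 1 = 0 -> e \in Fq -> c \in Fq ->
    (forall x, (e + Tr (eps * x) == 0) = (c + Tr (delta * x ^+ 2) != 0)) ->
  eps = 0 /\ delta = 0.
Proof.
move=> wE w_root eE cE excl.
have w_neq0 : w != 0.
  by apply/eqP => w0; move/eqP: w_root; rewrite w0 expr0n !add0r oner_eq0.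
have exclZ k x : k \in Fq ->
    (e + k * Tr (eps * x) == 0) = (c + k ^+ 2 * Tr (delta * x ^+ 2) != 0).
  move=> kE; have := excl (k * x).
  rewrite exprMn (mulrCA eps) (mulrCA delta) (reltraceZ _ kE).
  by rewrite (reltraceZ _ (rpredX 2 kE)).
have eps0 : eps = 0.
  apply/eqP/negPn/negP => /reltrace_nondegenerate[y Ty_neq0].
  (* The parameters are shifted by e / tau so that the zero falls at k = 0. *)
  pose tau := Tr (eps * y); pose s := Tr (delta * y ^+ 2).
  have rE : e / tau \in Fq by rewrite rpred_div ?reltrace_Fq.
  have zeros k : k \in Fq ->
      (k == 0) = (c + (e / tau) ^+ 2 * s + k ^+ 2 * s != 0).
    move=> kE; have := exclZ (e / tau + k) y (rpredD rE kE).
    rewrite mulrDl divfK// addrA (addrr_pchar2 pchar_L) add0r mulf_eq0.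
    rewrite (negPf Ty_neq0) orbF => ->; congr (_ != 0).
    rewrite -/s -addrA -mulrDl; congr (_ + _ * _).
    by rewrite exprDn_pchar// (eq_pnat _ (pcharf_eq pchar_L)).
  have z0 := zeros 0 (mem0v _); have z1 := zeros 1 (mem1v _).
  have zw := zeros w wE; move: z0 z1 zw.
  rewrite eqxx oner_eq0 (negPf w_neq0) expr0n mul0r addr0 expr1n mul1r.
  move=> /esym z0 /esym/negbFE/eqP z1 /esym/negbFE/eqP zw.
  have : w * s = 0.
    transitivity ((w ^+ 2 + w + 1) * s
      + (c + (e / tau) ^+ 2 * s + s) - (c + (e / tau) ^+ 2 * s + w ^+ 2 * s)
      - (1 + 1) * s); first by ring.
    by rewrite w_root z1 zw two0 !mul0r !subr0 addr0.
  move/eqP; rewrite mulf_eq0 (negPf w_neq0) /= => /eqP s0.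
  by move: z0 z1; rewrite s0 !mulr0 !addr0 => /eqP.
split=> //; apply/eqP/negPn/negP => /reltrace_nondegenerate[y].
have [x <-] := sqr_surj y; set s := Tr _ => s_neq0.
have {}exclZ k : k \in Fq -> (e == 0) = (c + k ^+ 2 * s != 0).
  by move=> kE; rewrite -exclZ// eps0 mul0r reltrace0 mulr0 addr0.
(* At this parameter the second expression is c + (c / s) s = 0. *)
have := exclZ ((c / s) ^+ (q %/ 2)).
rewrite rpredX ?rpred_div ?reltrace_Fq// => /(_ erefl).
rewrite Fq_sqrtK ?rpred_div ?reltrace_Fq// divfK// (addrr_pchar2 pchar_L).
rewrite eqxx /= => e_neq0.
have := exclZ 0 (mem0v _); have := exclZ 1 (mem1v _).
rewrite e_neq0 expr0n expr1n mul0r mul1r addr0.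
move=> /esym/negbFE/eqP cs /esym/negbFE/eqP c0.
by move: cs; rewrite c0 add0r; apply/eqP.
Qed.

(** * The polynomials h1 and f1 along the lines of direction gamma *)

Variables c1 c2 c3 gamma : L.
Local Notation h x := (h1 q c1 c2 c3).[x].
Local Notation f x := (f1 q c1 c2 c3 gamma).[x].

Lemma horner_h1 x :
  h x = Tr (c1 * x + c2 * x ^+ 2 + c3 * x ^+ 3 + x ^+ 2 * x ^+ q).
Proof. by rewrite /h1 /reltrace !hornerE addnC exprD. Qed.

Lemma horner_f1 x : f x = x + gamma * h x.
Proof. by rewrite /f1 !hornerE. Qed.

Lemma h1_Fq x : h x \in Fq.
Proof. by rewrite horner_h1 reltrace_Fq. Qed.

Let A := Tr (c3 * gamma ^+ 3 + gamma ^+ 2 * gamma ^+ q).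
Let B x := Tr (c2 * gamma ^+ 2)
           + Tr ((c3 * gamma ^+ 2 + (gamma ^+ q) ^+ 2) * x).
Let C x := Tr (c1 * gamma) + Tr ((c3 * gamma + gamma ^+ q) * x ^+ 2).

(** The conjugate x^q occurs in the coefficient of t^2 as gamma^2 x^q, which
has the same trace as gamma^(2 q) x; that is how eps arises. *)
Lemma h1_line x t : t \in Fq ->
  h (x + gamma * t) = h x + A * t ^+ 3 + B x * t ^+ 2 + C x * t.
Proof.
move=> tE.
pose b := c2 * gamma ^+ 2 + (c3 * gamma ^+ 2 * x + gamma ^+ 2 * x ^+ q).
have BE : B x = Tr b.
  rewrite !reltraceD -[in RHS](reltrace_frob (gamma ^+ 2 * _)) exprMn frobK.
  by rewrite /B mulrDl reltraceD (exprAC _ 2 q).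
pose a := c3 * gamma ^+ 3 + gamma ^+ 2 * gamma ^+ q.
pose c := c1 * gamma + (c3 * gamma + gamma ^+ q) * x ^+ 2.
have CE : C x = Tr c by rewrite reltraceD.
rewrite !horner_h1 BE CE -/(Tr a) (mulrC (Tr a)) (mulrC (Tr b)) (mulrC (Tr c)).
rewrite -!reltraceZ ?rpredX// -!reltraceD; congr Tr.
rewrite frobD exprMn (frob_Fq tE) /a /b /c.
set xq := x ^+ q; set gq := gamma ^+ q.
apply/eqP; rewrite -subr_eq0; apply/eqP.
(* The cross terms of the binomial expansions: the two sides differ by twice
   this sum. *)
transitivity ((1 + 1) * (c2 * x * gamma * t + c3 * x ^+ 2 * gamma * t
  + c3 * x * (gamma * t) ^+ 2 + x * xq * gamma * t + x * gamma * gq * t ^+ 2)).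
  by ring.
by rewrite two0 mul0r.
Qed.

Lemma f1_line x t : t \in Fq ->
  f (x + gamma * t) = f x + gamma * (A * t ^+ 3 + B x * t ^+ 2 + (1 + C x) * t).
Proof. by move=> tE; rewrite !horner_f1 h1_line//; ring. Qed.

Lemma f1_inj_conditions (w : L) :
    w \in Fq -> w ^+ 2 + w + 1 = 0 -> gamma != 0 ->
    injective (fun x => f x) ->
  [/\ gamma \in Fq, c3 = 1 &
      (Tr c2 == 0) = (1 + gamma * Tr c1 != 0)].
Proof.
move=> wE w_root g_neq0 f_inj.
have BE x : B x \in Fq by rewrite rpredD ?reltrace_Fq.
have CE x : 1 + C x \in Fq.
  by rewrite rpredD ?mem1v// rpredD ?reltrace_Fq.
have cubic x :
    {in Fq &, injective (fun t => A * t ^+ 3 + B x * t ^+ 2 + (1 + C x) * t)}.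
  move=> s t sE tE /= st; apply/(mulfI g_neq0)/(addrI x)/f_inj.
  by rewrite !f1_line// st.
have A0 : A = 0.
  apply: (cubic_inj pchar_L wE w_root _ (BE 0) (CE 0) (cubic 0)).
  exact: reltrace_Fq.
have excl x : (B x == 0) = (1 + C x != 0).
  apply: (quadratic_inj pchar_L (BE x) (CE x)) => s t sE tE /= st.
  by apply: (cubic x) => //=; rewrite A0 !mul0r !add0r.
have [] := @exclusive_zeros_const w (Tr (c2 * gamma ^+ 2)) (1 + Tr (c1 * gamma))
  (c3 * gamma ^+ 2 + (gamma ^+ q) ^+ 2) (c3 * gamma + gamma ^+ q) wE w_root.
- exact: reltrace_Fq.
- by rewrite rpredD ?mem1v ?reltrace_Fq.
- by move=> x; rewrite -(addrA 1); exact: excl.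
move=> eps0 /eqP; rewrite addr_eq0 (oppr_pchar2 pchar_L) => /eqP c3g.
(* Substituting c3 gamma = gamma^q into eps = 0. *)
have gE : gamma ^+ q = gamma.
  have gq_neq0 : gamma ^+ q != 0 by rewrite expf_neq0.
  apply/(mulfI gq_neq0); move/eqP: eps0.
  by rewrite addrC !expr2 mulrA c3g addr_eq0 (oppr_pchar2 pchar_L) => /eqP.
have c3_1 : c3 = 1 by apply: (mulIf g_neq0); rewrite c3g gE mul1r.
have gFq : gamma \in Fq by rewrite mem_FqE gE.
split=> //; have := excl 0.
rewrite /B /C expr0n !mulr0 reltrace0 !addr0 [c2 * _]mulrC [c1 * _]mulrC.
by rewrite !reltraceZ ?rpredX// mulf_eq0 expf_eq0 (negPf g_neq0).
Qed.

(** Here f1 x is the point of parameter t = h1 x on the line through x.  The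
cubic coefficient is the trace of gamma^3 + gamma^3 = 0. *)
Lemma h1_f1 x : gamma \in Fq -> c3 = 1 ->
  h (f x) = gamma ^+ 2 * Tr c2 * h x ^+ 2 + (1 + gamma * Tr c1) * h x.
Proof.
move=> gFq c3_1; rewrite horner_f1 h1_line ?h1_Fq// /A /B /C c3_1 !mul1r.
rewrite (frob_Fq gFq) -exprSr !(addrr_pchar2 pchar_L) !mul0r reltrace0 mul0r.
by rewrite !addr0 [c2 * _]mulrC [c1 * _]mulrC !reltraceZ ?rpredX//; ring.
Qed.

End QuadraticExtension.

(** * The compositional inverse *)

(* In the second case, 1 + gamma Tr(c1) != 0 says that the displayed quotient *)
(* is meaningful; division by zero is total in MathComp.                      *)
Theorem theorem4p1 (m q : nat) (K : finFieldType) (L : fieldExtType K)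
    (m_ge1 : (1 <= m)%N) (m_even : ~~ odd m) (q_def : q = (2 ^ m)%N)
    (card_K : #|K| = q) (dim_L : \dim {:L} = 2%N)
    (c1 c2 c3 gamma : L)
    (f1_perm : permutation_poly (f1 q c1 c2 c3 gamma)) :
  [\/ gamma = 0 /\
      compositional_inverse (f1 q c1 c2 c3 gamma) (fun x : L => x),
      [/\ gamma \in 1%VS /\ gamma != 0, c3 = 1, reltrace q c2 = 0,
          1 + gamma * reltrace q c1 != 0 &
          compositional_inverse (f1 q c1 c2 c3 gamma)
            (fun x : L => x + gamma * (h1 q c1 c2 c3).[x]
                                / (1 + gamma * reltrace q c1))]
    | [/\ gamma \in 1%VS /\ gamma != 0, c3 = 1, reltrace q c2 != 0 &
          compositional_inverse (f1 q c1 c2 c3 gamma)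
            (fun x : L => x + ((h1 q c1 c2 c3).[x] / reltrace q c2)
                                ^+ (q %/ 2))]].
Proof.
have f_inj := bij_inj f1_perm.
have inverse_of_cancel g : cancel (fun a : L => (f1 q c1 c2 c3 gamma).[a]) g ->
    compositional_inverse (f1 q c1 c2 c3 gamma) g.
  by move=> fK; split=> //; exact: (bij_can_sym f1_perm g).2 fK.
have [g0|g_neq0] := eqVneq gamma 0.
  constructor 1; split=> //; apply: inverse_of_cancel => x /=.
  by rewrite horner_f1 g0 mul0r addr0.
have [w w_root] : exists w : K, w ^+ 2 + w + 1 = 0.
  apply: finField_cube_root_unity; rewrite card_K q_def.
  (* 2^m is a power of 4. *)
  by rewrite -[m]odd_double_half (negPf m_even) -mul2n expnM -modnXm exp1n.
have wE : w%:A \in (1%AS : {subfield L}) by rewrite rpredZ ?mem1v.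
have wA_root : w%:A ^+ 2 + w%:A + 1 = 0 :> L.
  rewrite -[w%:A]/(in_alg L w) -rmorphXn -(rmorph1 (in_alg L)) -!rmorphD.
  by rewrite w_root rmorph0.
have L2 := pchar_L L q_def card_K.
have [gFq c3_1 excl] :=
  f1_inj_conditions m_ge1 q_def card_K dim_L wE wA_root g_neq0 f_inj.
have hf x := h1_f1 q_def card_K dim_L c1 c2 x gFq c3_1.
have [Tc2|Tc2] := eqVneq (reltrace q c2) 0.
  move: excl; rewrite Tc2 eqxx => /esym Tc1.
  constructor 2; split=> //; apply: inverse_of_cancel => x /=.
  rewrite hf Tc2 mulr0 mul0r add0r mulrCA mulrC mulKf// horner_f1.
  by rewrite -addrA (addrr_pchar2 L2) addr0.
constructor 3; split=> //; apply: inverse_of_cancel => x /=.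
move: excl; rewrite (negPf Tc2) => /esym/negbFE/eqP Tc1.
rewrite hf Tc1 mul0r addr0 mulrAC mulfK// -exprMn exprAC.
have ghE : gamma * (h1 q c1 c2 c3).[x] \in (1%AS : {subfield L}).
  by rewrite rpredM// (h1_Fq q_def card_K dim_L).
rewrite (Fq_sqrtK m_ge1 q_def card_K)// horner_f1.
by rewrite -addrA (addrr_pchar2 L2) addr0.
Qed.
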